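(* Let $n\ge 1$ be an integer, and let $f(n)$ be the probability that a given person $i\in\{0,1,\dots,n-1\}$ is unmatched at a circular table with $n$ people whose preferences are drawn uniformly at random from $\Pi_n=\{L,R\}^n$ (as defined in the context; the value does not depend on $i$). Then $$f(n)=\frac{1}{9}+\left(\frac{1}{2}\right)^n\left(\frac{2n}{3}-\frac{8}{9}+\frac{2}{n}\right)$$ when $n$ is odd, and $$f(n)=\frac{1}{9}-\left(\frac{1}{2}\right)^n\left(\frac{2n}{3}-\frac{8}{9}\right)$$ when $n$ is even.
   Context: People at the table are labeled $0,1,\dots,n-1$, with arithmetic on labels modulo $n$. Person $i$ has left neighbor $i-1$ and right neighbor $i+1$. A matching is a function $\mu:\{0,\dots,n-1\}\to\{0,\dots,n-1\}$ such that $\mu(i)\in\{i-1,i,i+1\}$ for all $i$, and $\mu(i)=j$ implies $\mu(j)=i$. Person $i$ is unmatched in $\mu$ if $\mu(i)=i$. Preferences are strings $\pi=\pi_0\pi_1\cdots\pi_{n-1}\in\Pi_n:=\{L,R\}^n$. If $\pi_i=L$, person $i$ strictly prefers $i-1$ to $i+1$; if $\pi_i=R$, person $i$ strictly prefers $i+1$ to $i-1$. In both cases $i$ strictly prefers being matched to either neighbor over being unmatched. (When $n=2$ the two neighbors coincide, and a person simply prefers being matched to the other person over being unmatched.) A matching $\mu$ is stable under $\pi$ if there is no blocking pair, i.e. no two neighbors $i$ and $i+1$ such that $\mu(i)\ne i+1$ and both strictly prefer each other to their current match (or to being unmatched, if they are unmatched). A string $\pi$ is regular if it contains at least one $L$ and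 at least one $R$, and irregular otherwise (all $L$'s or all $R$'s). For regular $\pi$ there is a unique stable matching, denoted $\mu_\pi$. Definition of $f(n)$: draw $\pi\in\Pi_n$ uniformly at random. If $\pi$ is regular, person $i$ is unmatched if and only if $\mu_\pi(i)=i$. If $\pi$ is irregular and $n$ is even, person $i$ is considered matched. If $\pi$ is irregular and $n$ is odd, person $i$ is by convention unmatched with (conditional) probability $1/n$. Then $f(n)$ is the resulting probability that $i$ is unmatched; that is, $$f(n)=\frac{\#\{\pi\in\Pi_n \text{ regular}:\mu_\pi(i)=i\}}{2^n}+\begin{cases}\frac{2}{2^n}\cdot\frac1n & n\text{ odd},\\ 0 & n\text{ even}.\end{cases}$$ *)

(* Defs.v *)
From mathcomp Require Import all_boot all_order all_algebra.
Set Implicit Arguments.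
Unset Strict Implicit.
Unset Printing Implicit Defensive.
Import GRing.Theory.
Local Open Scope ring_scope.

(* The people are the elements of 'I_n; the cyclic maps [ord_pred] and [ordS]
   give the left neighbor i - 1 and the right neighbor i + 1 modulo n. *)

Notation matching n := {ffun 'I_n -> 'I_n} (only parsing).

(* A string in {L, R}^n, where [false] stands for L and [true] for R. *)
Notation prefs n := {ffun 'I_n -> bool} (only parsing).

Definition is_matching (n : nat) (mu : matching n) : bool :=
  [forall i, mu i \in [:: ord_pred i; i; ordS i]] &&
  [forall i, forall j, (mu i == j) ==> (mu j == i)].

(* The possible partners of i from best to worst; being unmatched is having
   oneself as partner. Neighbors may coincide: for n = 2 this list is
   [:: j; j; i] with j the other person. *)
Definition pref_list (n : nat) (pi : prefs n) (i : 'I_n) : seq 'I_n :=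
  if pi i then [:: ordS i; ord_pred i; i] else [:: ord_pred i; ordS i; i].

(* [index] is the first position, so the relation is also right when entries
   of the list coincide (n <= 2). *)
Definition prefers (n : nat) (pi : prefs n) (i j k : 'I_n) : bool :=
  (index j (pref_list pi i) < index k (pref_list pi i))%N.

Definition blocking (n : nat) (pi : prefs n) (mu : matching n) (i : 'I_n) :=
  [&& mu i != ordS i,
      prefers pi i (ordS i) (mu i) &
      prefers pi (ordS i) i (mu (ordS i))].

Definition stable (n : nat) (pi : prefs n) (mu : matching n) : bool :=
  ~~ [exists i, blocking pi mu i].

Definition regular (n : nat) (pi : prefs n) : bool :=
  [exists i, ~~ pi i] && [exists i, pi i].

(* For regular pi there is exactly one stable matching, so that [pick] returns
   it; the default value and the irregular case are never used below. *)
Definition stable_matching (n : nat) (pi : prefs n) : matching n :=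
  odflt [ffun i => i] [pick mu : matching n | is_matching mu && stable pi mu].

(* The probability that person i is unmatched. For n odd each of the two
   irregular strings leaves i unmatched with probability 1 / n. *)
Definition f (n : nat) (i : 'I_n) : rat :=
  #|[set pi : prefs n | regular pi && (stable_matching pi i == i)]|%:R
    / 2%:R ^+ n
  + (if odd n then 2%:R / 2%:R ^+ n * (1 / n%:R) else 0).

(* Main.v *)
(* Only the maximal blocks R^a L^b and their junctions matter. In a regular
   circle, the middle R and L of a block are each other's favourites, and
   after removing them the rest of each run pairs off from the inside out, so a
   run has a leftover person, at its outer end, exactly when its length is
   even. At a junction L^b R^a two leftovers match each other; hence a person
   is unmatched iff the run starting with that person is even and the run
   behind it, of the other letter, is odd. The two mirror cases are equally
   frequent, and the words beginning with an even nonempty run of R and ending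
   with an odd run of L are counted by recursion on the first letter. *)
Require Import Defs.
From mathcomp Require Import all_boot all_order all_algebra.
From mathcomp Require Import zify ring lra.
Import GRing.Theory.
Set Implicit Arguments.
Unset Strict Implicit.
Unset Printing Implicit Defensive.

(** * Words over the two letters and their leading runs *)

(** Parity of the length of the leading run of R: an R in front flips it, an L resets it to even. *)
Fixpoint odd_run (w : seq bool) : bool :=
  if w is b :: v then b && ~~ odd_run v else false.

(** Reflecting the table reverses the order and swaps the letters, so a final run of L becomes a
    leading run of R. *)
Definition mirror (w : seq bool) : seq bool := rev (map negb w).

(* Words starting with an even positive number of [R] and ending with an odd
   number of [L]: read clockwise from a person, they leave that person
   unmatched. *)
Definition unpaired (w : seq bool) : bool :=
  [&& head false w, ~~ odd_run w & odd_run (mirror w)].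

Fixpoint words (n : nat) : seq (seq bool) :=
  if n is m.+1 then map (cons true) (words m) ++ map (cons false) (words m)
  else [:: [::]].

Lemma odd_run_rcons w b : odd_run (rcons w b) = odd_run w (+) (all id w && b).
Proof.
elim: w => [|c w IHw] /=; first by rewrite andbT.
by rewrite {}IHw; case: c; case: (odd_run w); case: (all _ _); case: b.
Qed.

Lemma odd_run_rcons_false w : odd_run (rcons w false) = odd_run w.
Proof. by rewrite odd_run_rcons andbF addbF. Qed.

Lemma odd_run_has w : odd_run w -> has id w.
Proof. by case: w => [|[] w]. Qed.

Lemma mirror_cons b w : mirror (b :: w) = rcons (mirror w) (~~ b).
Proof. by rewrite /mirror /= rev_cons. Qed.

Lemma mirrorK : involutive mirror.
Proof. by move=> w; rewrite /mirror map_rev revK (mapK negbK). Qed.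

Lemma size_mirror w : size (mirror w) = size w.
Proof. by rewrite size_rev size_map. Qed.

Lemma size_words n : size (words n) = 2 ^ n.
Proof.
by elim: n => //= n IHn; rewrite size_cat !size_map IHn addnn expnS mul2n.
Qed.

Lemma mem_words w : w \in words (size w).
Proof.
elim: w => //= b w IHw; rewrite mem_cat.
by case: b; rewrite map_f ?orbT.
Qed.

Lemma size_mem_words n w : w \in words n -> size w = n.
Proof.
elim: n w => [|n IHn] w /=; first by rewrite inE => /eqP ->.
by rewrite mem_cat => /orP[] /mapP[v /IHn <- ->].
Qed.

Lemma uniq_words n : uniq (words n).
Proof.
elim: n => //= n IHn.
rewrite cat_uniq !map_inj_uniq ?IHn /= => [|u v []//|u v []//].
rewrite andbT; apply/hasPn => _ /mapP[w _ ->].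
by apply/mapP => -[].
Qed.

Lemma perm_words n s :
  uniq s -> all (fun w => size w == n) s -> size s = 2 ^ n ->
  perm_eq s (words n).
Proof.
move=> uniq_s /allP size_s size2n.
have sub : {subset s <= words n}.
  by move=> w /size_s /eqP <-; apply: mem_words.
apply: (uniq_perm uniq_s (uniq_words n)).
by apply: (uniq_min_size uniq_s sub _).2; rewrite size2n size_words.
Qed.

Lemma perm_mirror_words n : perm_eq (map mirror (words n)) (words n).
Proof.
apply: perm_words; last by rewrite size_map size_words.
  by rewrite (map_inj_uniq (inv_inj mirrorK)) uniq_words.
apply/allP => _ /mapP[w /size_mem_words size_w ->].
by rewrite size_mirror size_w.
Qed.

Lemma count_wordsS (P : pred (seq bool)) n :
  count P (words n.+1) =
  count (P \o cons true) (words n) + count (P \o cons false) (words n).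
Proof. by rewrite /= count_cat !count_map. Qed.

(** * Recurrences for the word counts *)

Definition tail_count n := count (odd_run \o mirror) (words n).
Definition odd_odd_count n :=
  count (fun w => odd_run w && odd_run (mirror w)) (words n).
Definition even_odd_count n :=
  count (fun w => ~~ odd_run w && odd_run (mirror w)) (words n).

(** By mirroring, odd leading runs of R may be counted instead. Such a word is an R followed by a
    word without an odd leading run, which is the complementary count one length lower. *)
Lemma tail_countS n : tail_count n.+1 + tail_count n = 2 ^ n.
Proof.
have tailE m : tail_count m = count odd_run (words m).
  by rewrite /tail_count -count_map; apply/permP/perm_mirror_words.
rewrite !tailE count_wordsS [X in _ + X + _](@eq_count _ _ pred0) //.
rewrite count_pred0 addn0 -size_words -(count_predC odd_run) addnC.
by congr (_ + _); apply: eq_count.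
Qed.

Lemma odd_run_mirror_true w : odd_run (mirror (true :: w)) = odd_run (mirror w).
Proof. by rewrite mirror_cons odd_run_rcons_false. Qed.

Lemma odd_odd_countS n : odd_odd_count n.+1 = even_odd_count n.
Proof.
rewrite /odd_odd_count count_wordsS [X in _ + X](@eq_count _ _ pred0) //.
rewrite count_pred0 addn0; apply: eq_count => w.
by rewrite /comp odd_run_mirror_true.
Qed.

(* What remains on each side after cancelling the words starting with [R] is
   the number of words starting with [L] and ending with an odd run of [L]. *)
Lemma even_odd_countS n :
  even_odd_count n.+1 + tail_count n = odd_odd_count n + tail_count n.+1.
Proof.
rewrite /even_odd_count /tail_count !count_wordsS.
rewrite [X in _ = _ + (X + _)](@eq_count _ _ (odd_run \o mirror)); last first.
  by move=> w; rewrite /comp odd_run_mirror_true.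
rewrite [X in X + _ + _ = _](@eq_count _ _
    (fun w => odd_run w && odd_run (mirror w))); last first.
  by move=> w; rewrite /comp odd_run_mirror_true /= negbK.
rewrite -addnA; congr (_ + _).
by rewrite addnC; congr (_ + _); apply: eq_count.
Qed.

Lemma unpaired_countS n : count unpaired (words n.+1) = odd_odd_count n.
Proof.
rewrite count_wordsS [X in _ + X](@eq_count _ _ pred0) //.
rewrite count_pred0 addn0; apply: eq_count => w.
by rewrite /comp /unpaired odd_run_mirror_true /= negbK.
Qed.

(** * Walking once around the circle *)

(** A full turn from [s x] reads the turn from [x] with its first letter moved to the end. Since [q]
    fails somewhere, that letter cannot prolong the leading run when [q x] holds. *)
Lemma odd_run_traject (T : Type) (s : T -> T) (q : pred T) n x :
  iter n s x = x -> ~~ all q (traject s x n) ->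
  odd_run (map q (traject s x n)) =
  q x && ~~ odd_run (map q (traject s (s x) n)).
Proof.
case: n => // n; rewrite iterSr [traject s (s x) _]trajectSr trajectS /= => ->.
rewrite map_rcons odd_run_rcons all_map negb_and.
by case: (q x) => //= /negbTE ->; rewrite addbF.
Qed.

Lemma rev_traject (T : Type) (s p : T -> T) n x :
  cancel s p -> rev (traject s x n) = traject p (p (iter n s x)) n.
Proof.
move=> sK; elim: n => // n IHn.
by rewrite trajectSr rev_rcons IHn trajectS iterS sK.
Qed.

Lemma iter_can (T : Type) (s p : T -> T) n :
  cancel s p -> cancel (iter n s) (iter n p).
Proof. by move=> sK; elim: n => // n IHn x; rewrite iterSr iterS sK IHn. Qed.

Lemma val_iter_ordS n k (x : 'I_n) : iter k (@ordS n) x = (x + k) %% n :> nat.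
Proof.
elim: k => [|k IHk]; first by rewrite addn0 modn_small.
by rewrite iterS /= IHk -addn1 modnDml addn1 addnS.
Qed.

Lemma iter_ordS n (x : 'I_n) : iter n (@ordS n) x = x.
Proof. by apply/val_inj; rewrite /= val_iter_ordS modnDr modn_small. Qed.

Lemma iter_ord_pred n (x : 'I_n) : iter n (@ord_pred n) x = x.
Proof. by have := iter_can n (@ordSK n) x; rewrite iter_ordS. Qed.

Lemma mem_traject_ordS n (x y : 'I_n) : y \in traject (@ordS n) x n.
Proof.
have n_gt0 : 0 < n by case: n x {y} => // -[].
(* The witness is [y - x] modulo [n], written so that the subtraction does not truncate. *)
apply/trajectP; exists ((y + (n - x)) %% n); first by rewrite ltn_mod.
apply/val_inj; rewrite /= val_iter_ordS modnDmr addnCA subnKC; last exact/ltnW.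
by rewrite modnDr modn_small.
Qed.

Lemma rev_traject_ordS n (x : 'I_n) :
  rev (traject (@ordS n) x n) = traject (@ord_pred n) (ord_pred x) n.
Proof. by rewrite (rev_traject _ _ (@ordSK n)) iter_ordS. Qed.

Lemma mem_traject_ord_pred n (x y : 'I_n) : y \in traject (@ord_pred n) x n.
Proof. by rewrite -[x]ordSK -rev_traject_ordS mem_rev mem_traject_ordS. Qed.

(** * Run parities of a preference string and the edges they determine *)

Definition word n (pi : prefs n) (x : 'I_n) : seq bool :=
  map pi (traject (@ordS n) x n).

(* [rho pi x]: the maximal run of [R] starting at [x] and going right has odd
   length; [lam pi x]: the same for the run of [L] going left from [x]. *)
Definition rho n (pi : prefs n) (x : 'I_n) : bool := odd_run (word pi x).

Definition lam n (pi : prefs n) (x : 'I_n) : bool :=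
  odd_run (map (negb \o pi) (traject (@ord_pred n) x n)).

Lemma mirror_word n (pi : prefs n) x :
  mirror (word pi (ordS x)) = map (negb \o pi) (traject (@ord_pred n) x n).
Proof. by rewrite /mirror -map_comp -map_rev rev_traject_ordS ordSK. Qed.

Lemma regular_traject n (pi : prefs n) (x : 'I_n) : regular pi ->
  ~~ all pi (traject (@ordS n) x n) /\
  ~~ all (negb \o pi) (traject (@ord_pred n) x n).
Proof.
move=> /andP[/existsP[y Ly] /existsP[z Rz]]; rewrite -!has_predC; split.
  by apply/hasP; exists y; first exact: mem_traject_ordS.
by apply/hasP; exists z; [exact: mem_traject_ord_pred|rewrite /= negbK].
Qed.

(** With [lamE], this replaces parities of whole runs by one-step recurrences, so that the facts
    about [edge] become finite Boolean checks. *)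
Lemma rhoE n (pi : prefs n) x :
  regular pi -> rho pi x = pi x && ~~ rho pi (ordS x).
Proof.
by move=> /(regular_traject x)[+ _]; apply: odd_run_traject; apply: iter_ordS.
Qed.

Lemma lamE n (pi : prefs n) x :
  regular pi -> lam pi x = ~~ pi x && ~~ lam pi (ord_pred x).
Proof.
move=> /(regular_traject x)[_ +]; apply: odd_run_traject.
exact: iter_ord_pred.
Qed.

Lemma rho_pi n (pi : prefs n) x : regular pi -> rho pi x ==> pi x.
Proof. by move=> reg; rewrite rhoE //; case: (pi x); rewrite ?implybT. Qed.

Lemma lam_pi n (pi : prefs n) x : regular pi -> lam pi x ==> ~~ pi x.
Proof. by move=> reg; rewrite lamE //; case: (pi x); rewrite ?implybT. Qed.

(* In the stable matching, [x] is paired with [ordS x]; the last disjunct is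
   the junction of two runs whose leftovers meet. *)
Definition edge n (pi : prefs n) (x : 'I_n) : bool :=
  [|| rho pi x, lam pi (ordS x) |
      [&& ~~ pi x, pi (ordS x), ~~ lam pi x & ~~ rho pi (ordS x)]].

Lemma edge_disjoint n (pi : prefs n) x :
  regular pi -> edge pi x -> ~~ edge pi (ordS x).
Proof.
move=> reg; have := rhoE x reg; have := rhoE (ordS x) reg.
have := lamE (ordS x) reg; have := lamE (ordS (ordS x)) reg.
have := rho_pi (ordS (ordS x)) reg; have := lam_pi x reg.
rewrite /edge !ordSK.
case: (pi x); case: (pi (ordS x)); case: (pi (ordS (ordS x)));
case: (rho pi x); case: (rho pi (ordS x)); case: (rho pi (ordS (ordS x)));
case: (lam pi x); case: (lam pi (ordS x)); case: (lam pi (ordS (ordS x))) => //.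
Qed.

(** This is the stability of [edge_matching] in terms of edges: a pair not joined has a member
    already joined to its favourite. *)
Lemma edge_or_content n (pi : prefs n) x : regular pi ->
  [|| edge pi x, ~~ pi x && edge pi (ord_pred x)
    | pi (ordS x) && edge pi (ordS x)].
Proof.
move=> reg; have := rhoE x reg; have := rhoE (ordS x) reg.
have := lamE (ordS x) reg; have := lamE x reg.
have := rho_pi (ordS (ordS x)) reg; have := lam_pi (ord_pred x) reg.
rewrite /edge !ordSK !ord_predK.
case: (pi x); case: (pi (ordS x));
case: (rho pi x); case: (rho pi (ordS x));
case: (lam pi x); case: (lam pi (ordS x)); rewrite ?orbT //= ?orbT //.
Qed.

(** * Matchings and stability in Boolean form *)

Lemma neighbor_neq n (pi : prefs n) (x : 'I_n) :
  regular pi -> (ordS x != x) * (ord_pred x != x).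
Proof.
move=> /andP[/existsP[y Ly] /existsP[z Rz]].
have n_gt1 : 1 < n.
  case: n pi x y z Ly Rz => [|[|//]] pi x y z; first by case: x.
  by rewrite (ord1 y) (ord1 z) => /negbTE ->.
suff neq u : ordS u != u :> 'I_n.
  by split=> //; rewrite -{2}[x]ord_predK eq_sym.
apply/eqP => /(congr1 val) /=.
have := ltn_ord u; rewrite leq_eqVlt => /orP[/eqP uS|uS].
  by rewrite uS modnn; lia.
by rewrite modn_small //; lia.
Qed.

Lemma matchingP n (mu : matching n) :
  reflect ((forall x, mu x \in [:: ord_pred x; x; ordS x]) /\ involutive mu)
          (is_matching mu).
Proof.
apply: (iffP andP) => -[/forallP near inv]; split=> //; last first.
  by apply/'forall_forallP => x y; apply/implyP => /eqP <-; rewrite inv.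
by move=> x; move/'forall_forallP/(_ x (mu x)): inv; rewrite eqxx => /eqP.
Qed.

(** If [x] is not matched with [ordS x], being matched means having the left neighbor. So [x]
    refuses [ordS x] exactly when it is matched and prefers L; the same holds for [ordS x] with
    sides exchanged. *)
Lemma stableP n (pi : prefs n) (mu : matching n) :
  regular pi -> is_matching mu ->
  reflect (forall x, [|| mu x == ordS x, ~~ pi x && (mu x != x)
                       | pi (ordS x) && (mu (ordS x) != ordS x)])
          (stable pi mu).
Proof.
move=> reg /matchingP[near inv].
have neqS x := (neighbor_neq x reg).1; have neqP x := (neighbor_neq x reg).2.
rewrite /stable negb_exists; apply: equivP (forallP) _.
suff blockE x : blocking pi mu x = ~~ [|| mu x == ordS x,
    ~~ pi x && (mu x != x) | pi (ordS x) && (mu (ordS x) != ordS x)].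
  by split=> blk x; have := blk x; rewrite blockE negbK.
rewrite /blocking !negb_or; case: (boolP (mu x == ordS x)) => //= muxS.
have muSx : mu (ordS x) != x.
  by apply: contra muxS => /eqP {1}<-; rewrite inv.
rewrite !negb_and !negbK /prefers /pref_list; congr andb.
  case: (pi x) => /=; first by rewrite eqxx eq_sym (negbTE muxS).
  have := near x; rewrite !inE (negbTE muxS) orbF => /orP[/eqP ->|/eqP ->].
    by rewrite (negbTE (neqP x)) !eqxx ltn0.
  (* At a table of two the neighbors coincide and [ordS x] has index 0 rather than 1; both are below
     the index 2 of [x]. *)
  by rewrite (negbTE (neqP x)) (negbTE (neqS x)) !eqxx; case: eqP.
have := near (ordS x); rewrite !inE ordSK (negbTE muSx) /= => near_Sx.
case: (pi (ordS x)) => /=; last by rewrite eqxx eq_sym (negbTE muSx).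
case/orP: near_Sx => /eqP ->; last first.
  by rewrite (negbTE (neqS (ordS x))) !eqxx ltn0.
rewrite !eqxx (negbTE (neqS (ordS x))) [x == ordS x]eq_sym (negbTE (neqS x)).
by case: eqP.
Qed.

(** * Existence of a stable matching, and matches forced in every one *)

Definition edge_matching n (pi : prefs n) : matching n :=
  [ffun x => if edge pi x then ordS x
             else if edge pi (ord_pred x) then ord_pred x else x].

Lemma edge_matchingP n (pi : prefs n) :
  regular pi -> is_matching (edge_matching pi).
Proof.
move=> reg; apply/matchingP; split=> x; rewrite !ffunE.
  by case: ifP => _; last case: ifP => _; rewrite !inE eqxx ?orbT.
case: (boolP (edge pi x)) => [ex|nex].
  by rewrite (negbTE (edge_disjoint reg ex)) ordSK ex.
case: (boolP (edge pi (ord_pred x))) => [->|nepx]; first by rewrite ord_predK.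
by rewrite (negbTE nex) (negbTE nepx).
Qed.

Lemma edge_matching_stable n (pi : prefs n) :
  regular pi -> stable pi (edge_matching pi).
Proof.
move=> reg; apply/(stableP reg (edge_matchingP reg)) => x; rewrite !ffunE ordSK.
have neqS y := (neighbor_neq y reg).1; have neqP y := (neighbor_neq y reg).2.
have := edge_or_content x reg.
case: (edge pi x) => /= [|/orP[]/andP[-> ->] /=]; first by rewrite eqxx.
  by rewrite neqP orbT.
by rewrite neqS !orbT.
Qed.

(* Going down the run two steps at a time: its last person and the opposite
   person next to it are each other's favourites, and each pair so removed
   exposes another such pair. *)
Lemma odd_run_match (T : eqType) (s : T -> T) (q : pred T) (mu : T -> T) :
  injective s -> involutive mu ->
  (forall x, mu (s x) \in [:: x; s x; s (s x)]) ->
  (forall x, [|| mu x == s x, ~~ q x && (mu x != x)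
               | q (s x) && (mu (s x) != s x)]) ->
  forall m x, ~~ all q (traject s x m) -> odd_run (map q (traject s x m)) ->
  mu x = s x.
Proof.
move=> s_inj muK near st m; have [k] := ubnP m.
elim: k m => // k IHk [|[|m]] // + x.
  by rewrite /= => _; case: (q x).
rewrite !ltnS /= => m_lt; have := st x.
case: (boolP (q x)) => //= qx; case: (boolP (q (s x))) => //= qsx; last first.
  by rewrite orbF => /eqP.
rewrite negbK => stx not_all /(IHk m (ltnW m_lt) _ not_all) muss.
case/orP: stx => [/eqP //|mus].
have := near x; rewrite !inE (negbTE mus) /= => /orP[/eqP mus1|/eqP mus2].
  by rewrite -{1}mus1 muK.
(* If [s x] took [s (s x)], the walk would close up into a cycle of length two on which [q] always
   holds. *)
have /s_inj xss : s x = s (s (s x)) by rewrite -muss -mus2 muK.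
case/negP: not_all; rewrite -xss => {m_lt}.
have [] // : all q (traject s x m) /\ all q (traject s (s x) m).
by elim: m => //= m [IH1 IH2]; rewrite -xss qx qsx IH1 IH2.
Qed.

Lemma rho_match n (pi : prefs n) (mu : matching n) x :
  regular pi -> is_matching mu -> stable pi mu -> rho pi x -> mu x = ordS x.
Proof.
move=> reg mu_ok /(stableP reg mu_ok) st.
have [near inv] := matchingP _ mu_ok.
apply: (odd_run_match (@ordS_inj n) inv _ st).
  by move=> y; have := near (ordS y); rewrite ordSK.
exact: (regular_traject x reg).1.
Qed.

Lemma lam_match n (pi : prefs n) (mu : matching n) x :
  regular pi -> is_matching mu -> stable pi mu -> lam pi x ->
  mu x = ord_pred x.
Proof.
move=> reg mu_ok /(stableP reg mu_ok) st.
have [near inv] := matchingP _ mu_ok.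
apply: (odd_run_match (can_inj (@ord_predK n)) inv).
- move=> y; have := near (ord_pred y); rewrite ord_predK !inE.
  by case/or3P=> ->; rewrite ?orbT.
- move=> y; have := st (ord_pred y); rewrite ord_predK /= negbK.
  (* A pair is matched as seen from its right end exactly when it is as seen from its left end. *)
  have -> : (mu y == ord_pred y) = (mu (ord_pred y) == y).
    by rewrite (can2_eq inv inv) eq_sym.
  by case/or3P=> ->; rewrite ?orbT.
exact: (regular_traject x reg).2.
Qed.

Lemma edge_match n (pi : prefs n) (mu : matching n) x :
  regular pi -> is_matching mu -> stable pi mu -> edge pi x -> mu x = ordS x.
Proof.
move=> reg mu_ok st; have [near inv] := matchingP _ mu_ok.
have rhoP := rho_match reg mu_ok st; have lamP := lam_match reg mu_ok st.
case/or3P=> [/rhoP//|/lamP|]; first by rewrite ordSK => {1}<-; rewrite inv.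
case/and4P=> Lx RSx; rewrite lamE // rhoE // Lx RSx /= !negbK => lam_px rho_ssx.
have /or3P[/eqP//|/andP[_]|/andP[_]] := (stableP reg mu_ok st) x.
  have := near x; rewrite !inE => /or3P[/eqP mu_x _|->//|/eqP//].
  (* By its own run, [ord_pred x] is matched to its left. Being also matched with [x], it would
     coincide with [ordS x] and have both preferences. *)
  have := inv x; rewrite mu_x (lamP _ lam_px) => /(canRL (@ord_predK n)) px.
  by move: lam_px; rewrite lamE // px RSx.
have := near (ordS x); rewrite ordSK !inE => /or3P[/eqP mu_sx _|->//|].
  by rewrite -{1}mu_sx inv.
move=> /eqP mu_sx _; have := inv (ordS x).
rewrite mu_sx (rhoP _ rho_ssx) => /(@ordS_inj n) ssx.
by move: rho_ssx; rewrite rhoE // ssx (negbTE Lx).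
Qed.

Lemma stable_matching_regular n (pi : prefs n) : regular pi ->
  is_matching (stable_matching pi) /\ stable pi (stable_matching pi).
Proof.
move=> reg; rewrite /stable_matching; case: pickP => [mu /andP[]//|/(_ _) none].
have := none (edge_matching pi).
by rewrite edge_matchingP ?edge_matching_stable.
Qed.

(** Edges at [x] force a match. Conversely, if [x] has no edge but is matched with a neighbor,
    stability of the edges gives that neighbor an edge on its far side; this forces its partner
    there to be [x], which has no edge. *)
Lemma unmatched_edge n (pi : prefs n) x : regular pi ->
  (stable_matching pi x == x) = ~~ edge pi x && ~~ edge pi (ord_pred x).
Proof.
move=> reg; have [mu_ok st] := stable_matching_regular reg.
have [near inv] := matchingP _ mu_ok; have edgeP := edge_match reg mu_ok st.
have [neqS neqP] := neighbor_neq x reg.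
move: (stable_matching pi) => mu in near inv edgeP *.
have [/edgeP->|nex] /= := boolP (edge pi x); first exact/negbTE.
have [/edgeP|nepx] /= := boolP (edge pi (ord_pred x)).
  by rewrite ord_predK => {1}<-; rewrite inv; apply/negbTE.
have := near x; rewrite !inE => /or3P[/eqP mu_x|//|/eqP mu_x].
  have := edge_or_content (ord_pred x) reg.
  rewrite ord_predK (negbTE nepx) (negbTE nex) andbF orbF /= => /andP[_ eppx].
  have := edgeP _ eppx; rewrite ord_predK -{2}mu_x => /(inv_inj inv) ppx.
  by rewrite ppx (negbTE nex) in eppx.
have := edge_or_content x reg.
rewrite (negbTE nepx) (negbTE nex) andbF /= => /andP[_ esx].
have := edgeP _ esx; rewrite -{1}mu_x inv => /(canLR (@ordSK n)) sx.
by rewrite -sx (negbTE nepx) in esx.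
Qed.

(** * From unmatched persons to words *)

Lemma has_mirror q w : has q (mirror w) = has (q \o negb) w.
Proof. by rewrite has_rev has_map. Qed.

Lemma unpaired_both w : unpaired w -> has id w && has negb w.
Proof.
case/and3P=> hw _ /odd_run_has; rewrite has_mirror => ->.
by case: w hw => // -[].
Qed.

(** Irregular strings thus drop out of the word count by themselves. *)
Lemma unpaired_regular n (pi : prefs n) x y :
  unpaired (word pi x) || unpaired (mirror (word pi y)) -> regular pi.
Proof.
suff both z : has id (word pi z) && has negb (word pi z) -> regular pi.
  case/orP=> /unpaired_both; first exact: both.
  rewrite !has_mirror andbC => /andP[h1 h2]; apply: (both y).
  by rewrite h2 andbT; apply: sub_has h1 => b /negbNE.
rewrite /word !has_map => /andP[/hasP[u _ Ru] /hasP[v _ Lv]].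
by apply/andP; split; apply/existsP; [exists v|exists u].
Qed.

Lemma head_map_traject n (s : 'I_n -> 'I_n) (q : pred 'I_n) x :
  head false (map q (traject s x n)) = q x.
Proof. by case: n x s q => [[]|]. Qed.

Lemma unpaired_word n (pi : prefs n) x :
  unpaired (word pi x) = [&& pi x, ~~ rho pi x & lam pi (ord_pred x)].
Proof.
by rewrite /unpaired head_map_traject /lam -mirror_word ord_predK.
Qed.

Lemma unpaired_mirror_word n (pi : prefs n) x :
  unpaired (mirror (word pi (ordS x))) =
  [&& ~~ pi x, ~~ lam pi x & rho pi (ordS x)].
Proof. by rewrite /unpaired mirrorK mirror_word head_map_traject. Qed.

Lemma unmatched_word n (pi : prefs n) x :
  regular pi && (stable_matching pi x == x) =
  unpaired (word pi x) || unpaired (mirror (word pi (ordS x))).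
Proof.
have [reg|irr] := boolP (regular pi); last first.
  by apply/esym; apply: contraNF irr; apply: unpaired_regular.
rewrite unmatched_edge //= unpaired_word unpaired_mirror_word.
have := rhoE x reg; have := rhoE (ord_pred x) reg.
have := lamE x reg; have := lamE (ordS x) reg; have := lamE (ord_pred x) reg.
have := rhoE (ordS x) reg.
rewrite /edge !ordSK !ord_predK.
case: (pi x); case: (pi (ordS x)); case: (pi (ord_pred x));
case: (rho pi x); case: (rho pi (ordS x)); case: (rho pi (ord_pred x));
case: (lam pi x); case: (lam pi (ordS x)); case: (lam pi (ord_pred x)) => //=.
Qed.

Lemma word_inj n (x : 'I_n) : injective (fun pi : prefs n => word pi x).
Proof.
move=> pi1 pi2 /eq_in_map eq12; apply/ffunP => y.
exact/eq12/mem_traject_ordS.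
Qed.

(** Reading from any person is a bijection from strings to words, so the counts do not depend on the
    person. *)
Lemma perm_word n (x : 'I_n) :
  perm_eq [seq word pi x | pi : prefs n] (words n).
Proof.
apply: perm_words; first by rewrite map_inj_uniq ?enum_uniq //; apply: word_inj.
  apply/allP => _ /mapP[pi _ ->].
  by rewrite /word size_map size_traject.
by rewrite size_map -cardE card_ffun card_bool card_ord.
Qed.

Lemma card_unmatched n (x : 'I_n) :
  #|[set pi : prefs n | regular pi && (stable_matching pi x == x)]| =
  2 * count unpaired (words n).
Proof.
have countE (P : pred (seq bool)) y :
    #|[set pi : prefs n | P (word pi y)]| = count P (words n).
  rewrite -(permP (perm_word y)) count_map cardsE cardE size_filter enumT.
  exact: eq_count.
transitivity #|[set pi : prefs n | unpaired (word pi x)] :|: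
               [set pi : prefs n | unpaired (mirror (word pi (ordS x)))]|.
  by apply: eq_card => pi; rewrite !inE unmatched_word.
(* The two mirror cases exclude each other because they prescribe different letters at [x]. *)
rewrite cardsU [X in _ - X](_ : _ = 0) ?subn0; last first.
  apply: eq_card0 => pi; rewrite !inE unpaired_word unpaired_mirror_word.
  by case: (pi x); rewrite ?andbF.
rewrite !countE (countE (unpaired \o mirror)) -count_map.
by rewrite (permP (perm_mirror_words n)) addnn mul2n.
Qed.

(** * Closed forms and the final formula *)

Local Open Scope ring_scope.

Lemma tail_countE n : 3 * (tail_count n)%:R = 2 ^+ n - (-1) ^+ n :> rat.
Proof.
elim: n => [|n IHn]; first by rewrite !expr0 subrr mulr0.
have /(congr1 (fun m => m%:R : rat)) := tail_countS n.
rewrite natrD natrX !exprS; lra.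
Qed.

(** The recurrences combine to [a(n+2) = a(n) + t(n+1) - t(n)], with [t] the tail count. Its
    alternating part resonates with the homogeneous solution [(-1)^n], whence the linear factor. *)
Lemma odd_odd_countE n :
  9 * (odd_odd_count n)%:R = 2 ^+ n + (-1) ^+ n * (3 * n%:R - 1) :> rat.
Proof.
(* Two consecutive values are carried along because the recurrence has order two. *)
suff [] :
  9 * (odd_odd_count n)%:R = 2 ^+ n + (-1) ^+ n * (3 * n%:R - 1) :> rat /\
  9 * (odd_odd_count n.+1)%:R =
    2 ^+ n.+1 + (-1) ^+ n.+1 * (3 * n.+1%:R - 1) :> rat by [].
elim: n => [|n [IH0 IH1]]; first by split.
split=> //; rewrite odd_odd_countS.
have /(congr1 (fun m => m%:R : rat)) := even_odd_countS n.
have := tail_countE n; have := tail_countE n.+1.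
rewrite !natrD !exprS -addn2 -addn1 !natrD; lra.
Qed.


Theorem theorem1 (n : nat) (hn : (1 <= n)%N) (i : 'I_n) :
  (odd n ->
     f i = 1 / 9%:R
           + (1 / 2%:R) ^+ n * (2%:R * n%:R / 3%:R - 8%:R / 9%:R + 2%:R / n%:R))
  /\
  (~~ odd n ->
     f i = 1 / 9%:R
           - (1 / 2%:R) ^+ n * (2%:R * n%:R / 3%:R - 8%:R / 9%:R)).
Proof.
rewrite /f card_unmatched.
case: n hn i => // m _ _; rewrite unpaired_countS natrM.
have countE := odd_odd_countE m.
have pow_neq0 : 2 ^+ m.+1 != 0 :> rat by rewrite expf_neq0.
have mS_neq0 : m.+1%:R != 0 :> rat by rewrite Num.Theory.pnatr_eq0.
have -> : (odd_odd_count m)%:R =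
    (2 ^+ m + (-1) ^+ m * (3 * m%:R - 1)) / 9 :> rat.
  by rewrite -countE; field.
have pow2 : 2 ^+ m.+1 = 2 * 2 ^+ m :> rat by rewrite exprS.
have mS : m.+1%:R = m%:R + 1 :> rat by rewrite -addn1 natrD.
(* Since [n = m + 1], the sign [(-1)^m] is positive exactly for odd [n], where the irregular strings
   also contribute the term in [2/n]. *)
rewrite -signr_odd expr_div_n expr1n /=; split=> [/negbTE ->|].
  rewrite pow2 mS expr0 in pow_neq0 mS_neq0 *.
  by rewrite /=; field; rewrite mS_neq0 expf_neq0.
rewrite negbK => odd_m; rewrite odd_m /= addr0 expr1.
rewrite pow2 mS in pow_neq0 mS_neq0 *.
by field; rewrite expf_neq0.
Qed.
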